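(* Let $C$ be a tamely laced generalized Cartan matrix, let $\ell\ge 2$ be an integer, and let $R$ be any commutative ring over $\mathbb{Z}$ with identity element. For any family $T_\ell=\{T^{(a)}_m(u)\in R^{\times}\mid a\in I;\ m=1,\dots,t_a\ell-1;\ u\in U\}$ satisfying the level $\ell$ restricted T-system $\mathbb{T}_\ell(C)$ in $R$, define a family $Y_\ell=\{Y^{(a)}_m(u)\in R^{\times}\mid a\in I;\ m=1,\dots,t_a\ell-1;\ u\in U\}$ by $$Y^{(a)}_m(u)=\frac{M^{(a)}_m(u)}{T^{(a)}_{m-1}(u)T^{(a)}_{m+1}(u)},$$ where $T^{(a)}_0(u)=T^{(a)}_{t_a\ell}(u)=1$. Then $Y_\ell$ satisfies the level $\ell$ restricted Y-system $\mathbb{Y}_\ell(C)$ in $R$.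
   Context: $\mathbb{N}=\mathbb{Z}_{>0}$; $R^\times$ is the group of invertible elements of $R$. A generalized Cartan matrix is an integer matrix $C=(C_{ij})_{i,j\in I}$, $I=\{1,\dots,r\}$, with $C_{ii}=2$, $C_{ij}\le 0$ for $i\ne j$, and $C_{ij}=0$ iff $C_{ji}=0$. It is symmetrizable if there is $D=\mathrm{diag}(d_1,\dots,d_r)$, $d_i\in\mathbb{N}$, with $DC$ symmetric; $D$ is fixed, with no common divisor of $d_1,\dots,d_r$ other than 1. $C$ is tamely laced if it is symmetrizable and: if $C_{ij}<-1$, then $d_i=-C_{ji}=1$. Put $t=\mathrm{lcm}(d_1,\dots,d_r)$, $t_a=t/d_a$, and write $a\sim b$ if $C_{ab}<0$. $U$ is any one of: $\frac1t\mathbb{Z}$; the complex plane $\mathbb{C}$; or the cylinder $\mathbb{C}_\xi=\mathbb{C}/(2\pi\sqrt{-1}/\xi)\mathbb{Z}$ for some $\xi\in\mathbb{C}\setminus 2\pi\sqrt{-1}\,\mathbb{Q}$. Level $\ell$ restricted T-system $\mathbb{T}_\ell(C)$: the relations, for all $a\in I$, $m=1,\dots,t_a\ell-1$, $u\in U$, $$T^{(a)}_m\left(u-\tfrac{d_a}{t}\right)T^{(a)}_m\left(u+\tfrac{d_a}{t}\right)=T^{(a)}_{m-1}(u)T^{(a)}_{m+1}(u)+M^{(a)}_m(u),$$ where $T^{(a)}_0(u)=1$ and $T^{(a)}_{t_a\ell}(u)=1$ whenever they occur on the right-hand sides, and $$M^{(a)}_m(u)=\prod_{b:b\sim a}T^{(b)}_{\frac{d_a}{d_b}m}(u)\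 \text{ if } d_a>1,\qquad M^{(a)}_m(u)=\prod_{b:b\sim a}S^{(b)}_m(u)\ \text{ if } d_a=1,$$ $$S^{(b)}_m(u)=\prod_{k=1}^{d_b}T^{(b)}_{1+E\left[\frac{m-k}{d_b}\right]}\left(u+\tfrac1t\left(2k-1-m+E\left[\tfrac{m-k}{d_b}\right]d_b\right)\right),$$ with $E[x]$ the largest integer not exceeding $x\in\mathbb{Q}$. Level $\ell$ restricted Y-system $\mathbb{Y}_\ell(C)$: the relations, for all $a\in I$, $m=1,\dots,t_a\ell-1$, $u\in U$, $$Y^{(a)}_m\left(u-\tfrac{d_a}{t}\right)Y^{(a)}_m\left(u+\tfrac{d_a}{t}\right)=\frac{N^{(a)}_m(u)}{(1+Y^{(a)}_{m-1}(u)^{-1})(1+Y^{(a)}_{m+1}(u)^{-1})},$$ where $Y^{(a)}_0(u)^{-1}=0$ and $Y^{(a)}_{t_a\ell}(u)^{-1}=0$ whenever they occur on the right-hand sides, $N^{(a)}_m(u)=\prod_{b:b\sim a}Z^{(b)}_{\frac{d_a}{d_b},m}(u)$ if $d_a>1$, and $N^{(a)}_m(u)=\prod_{b:b\sim a}\left(1+Y^{(b)}_{\frac{m}{d_b}}(u)\right)$ if $d_a=1$, with $Y^{(b)}_{\frac{m}{d_b}}(u)=0$ if $\frac{m}{d_b}\notin\mathbb{N}$. Here for $p\in\mathbb{N}$ $$Z^{(b)}_{p,m}(u)=\prod_{j=-p+1}^{p-1}\left\{\prod_{k=1}^{p-|j|}\left(1+Y^{(b)}_{pm+j}\left(u+\tfrac1t(p-|j|+1-2k)\right)\right)\right\}.$$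 (For $C$ tamely laced, $a\sim b$ and $d_a>1$ imply $\frac{d_a}{d_b}\in\{1,d_a\}$.) *)

(* Defs.v *)
From HB Require Import structures.
From mathcomp Require Import all_boot all_order all_algebra.
From mathcomp Require Import complex boolp reals trigo.

Set Implicit Arguments.
Unset Strict Implicit.
Unset Printing Implicit Defensive.

Import Order.TTheory GRing.Theory Num.Theory.

Local Open Scope ring_scope.
Local Open Scope complex_scope.

(* The index set I = {1, ..., r} is rendered as 'I_r. *)
Section Cartan.
Variables (r : nat) (C : 'M[int]_r) (d : 'I_r -> nat).

Definition generalized_Cartan : Prop :=
  [/\ forall i, C i i = 2,
      forall i j, i != j -> C i j <= 0
    & forall i j, C i j = 0 <-> C j i = 0].

(* [d] lists the diagonal of the fixed matrix D. *)
Definition symmetrizer : Prop :=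
  let D := diag_mx (\row_i (d i)%:Z) in
  [/\ forall i, (0 < d i)%N,
      (D *m C)^T = D *m C
    & forall c : nat, (forall i, (c %| d i)%N) -> c = 1%N].

Definition tamely_laced : Prop :=
  [/\ generalized_Cartan, symmetrizer
    & forall i j, C i j < -1 -> d i = 1%N /\ - C j i = 1].

Definition adj (a b : 'I_r) : bool := C a b < 0.

(* t = lcm(d_1, ..., d_r) and t_a = t / d_a. *)
Definition lcmd : nat := \big[lcmn/1%N]_i d i.

Definition lcmd_quo (a : 'I_r) : nat := (lcmd %/ d a)%N.

End Cartan.

(* The additive group (1/t)Z, as a subgroup of the rationals. *)
Definition in_fracZ (t : nat) : {pred rat} :=
  [pred x : rat | x * t%:R \is a Num.int].

Fact in_fracZ_zmod_closed t : zmod_closed (in_fracZ t).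
Proof.
split=> [|x y]; rewrite !inE ?mul0r ?rpred0 // => hx hy.
by rewrite mulrBl rpredB.
Qed.
HB.instance Definition _ t :=
  GRing.isZmodClosed.Build rat (in_fracZ t) (in_fracZ_zmod_closed t).

Record fracZ (t : nat) := FracZ { fracZ_val : rat; _ : fracZ_val \in in_fracZ t }.
HB.instance Definition _ t := [isSub for @fracZ_val t].
HB.instance Definition _ t := [Choice of fracZ t by <:].
HB.instance Definition _ t := [SubChoice_isSubZmodule of fracZ t by <:].

Fact in_fracZ_inv t : t%:R^-1 \in in_fracZ t.
Proof.
rewrite inE; case: t => [|t]; first by rewrite mulr0 rpred0.
by rewrite mulVf ?rpred1 // pnatr_eq0.
Qed.

Section Cylinder.
Variables (K : realType) (xi : K[i]).

Definition two_pi_i : K[i] := (2 * pi)%:C * 'i%C.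

Definition periods : {pred K[i]} :=
  [pred z : K[i] | `[< exists n : int, z = (two_pi_i / xi) *~ n >]].

Fact periods_zmod_closed : zmod_closed periods.
Proof.
split=> [|x y]; rewrite !inE.
  by apply/asboolP; exists 0; rewrite mulr0z.
move=> /asboolP[m ->] /asboolP[n ->]; apply/asboolP.
by exists (m - n); rewrite mulrzBr.
Qed.
HB.instance Definition _ :=
  GRing.isZmodClosed.Build K[i] periods periods_zmod_closed.

Definition cylinder : zmodType := Quotient.quot periods.

End Cylinder.

(* The three choices for the set U of values of the parameter u. *)
Inductive spectral_domain (K : realType) : Type :=
| LatticeU
| PlaneU
| CylinderU (xi : K[i]) of
    (forall q : rat, xi <> two_pi_i K * ratr q).

Definition spectral (K : realType) (t : nat) (s : spectral_domain K) : zmodType :=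
  match s with
  | LatticeU => fracZ t
  | PlaneU => K[i]
  | CylinderU xi _ => cylinder xi
  end.

(* The element 1/t of U; u + k/t is then [u + spectral_inv t s *~ k]. *)
Definition spectral_inv (K : realType) (t : nat) (s : spectral_domain K) :
    spectral t s :=
  match s return spectral t s with
  | LatticeU => FracZ (in_fracZ_inv t)
  | PlaneU => t%:R^-1
  | CylinderU xi _ => \pi_(cylinder xi)%qT (t%:R^-1)
  end.

(* A family (X^(a)_m(u)) is a function X of a, m, u with integer index m, of
   which only the values at 1 <= m <= t_a * l - 1 are ever used: boundary values
   are supplied by [Tbd], [Yinvbd] and [Yquo].  The element [e] of U is 1/t. *)
Section Systems.
Variables (r : nat) (C : 'M[int]_r) (d : 'I_r -> nat) (l : nat).
Variables (U : zmodType) (e : U) (R : comUnitRingType).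
Implicit Types (T Y : 'I_r -> int -> U -> R) (a b : 'I_r) (m : int) (u : U).

Definition top a : int := (lcmd_quo d a * l)%N.

Definition in_range a m : bool := 1 <= m <= top a - 1.

Definition boundary a m : bool := (m == 0) || (m == top a).

Definition unit_family (X : 'I_r -> int -> U -> R) : Prop :=
  forall a m u, in_range a m -> X a m u \is a GRing.unit.

Definition Tbd T a m u : R := if boundary a m then 1 else T a m u.

(* For d > 0, [(x %/ d)%Z] is the integer part E[x / d]. *)
Definition T_S T b m u : R :=
  \prod_(1 <= k < (d b).+1)
    let E := ((m - k%:Z) %/ (d b)%:Z)%Z in
    Tbd T b (1 + E) (u + e *~ (2 * k%:Z - 1 - m + E * (d b)%:Z)).

(* d a / d b is exact when C is tamely laced, 1 < d a and a ~ b. *)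
Definition T_M T a m u : R :=
  if (1 < d a)%N then
    \prod_(b | adj C a b) Tbd T b ((d a %/ d b)%N%:Z * m) u
  else \prod_(b | adj C a b) T_S T b m u.

Definition T_system T : Prop :=
  forall a m u, in_range a m ->
    T a m (u - e *+ d a) * T a m (u + e *+ d a)
    = Tbd T a (m - 1) u * Tbd T a (m + 1) u + T_M T a m u.

Definition Yinvbd Y a m u : R := if boundary a m then 0 else (Y a m u)^-1.

(* The index j = -p+1, ..., p-1 is written j = i - (p-1) with 0 <= i < 2p-1. *)
Definition Y_Z Y b (p : nat) m u : R :=
  \prod_(0 <= i < (2 * p)%N.-1)
    let j : int := i%:Z - (p%:Z - 1) in
    \prod_(1 <= k < (p - `|j|)%N.+1)
      (1 + Y b (p%:Z * m + j) (u + e *~ (p%:Z - `|j| + 1 - 2 * k%:Z))).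

(* Y^(b)_{m/d_b}(u), for m > 0. *)
Definition Yquo Y b m u : R :=
  if ((d b)%:Z %| m)%Z then Y b (m %/ (d b)%:Z)%Z u else 0.

Definition Y_N Y a m u : R :=
  if (1 < d a)%N then \prod_(b | adj C a b) Y_Z Y b (d a %/ d b) m u
  else \prod_(b | adj C a b) (1 + Yquo Y b m u).

(* The right-hand side is a fraction in R, so its denominator has to be
   invertible; [x^-1] is meaningless in MathComp for a non-unit x. *)
Definition Y_system Y : Prop :=
  forall a m u, in_range a m ->
    let den := (1 + Yinvbd Y a (m - 1) u) * (1 + Yinvbd Y a (m + 1) u) in
    den \is a GRing.unit /\
    Y a m (u - e *+ d a) * Y a m (u + e *+ d a) = Y_N Y a m u / den.

Definition Y_of_T T a m u : R :=
  T_M T a m u / (Tbd T a (m - 1) u * Tbd T a (m + 1) u).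

End Systems.

(* Main.v *)
Require Import Defs.
From mathcomp Require Import all_boot all_order all_algebra reals.
From mathcomp Require Import ring zify.

Set Implicit Arguments.
Unset Strict Implicit.
Unset Printing Implicit Defensive.

Import Order.TTheory GRing.Theory Num.Theory.

Local Open Scope ring_scope.

(** Put F^a_m(u) = T^(a)_m(u) for 1 <= m <= t_a l - 1 and F^a_m(u) = 1 for every
    other m; all the values of F are invertible.  Dividing a T-relation by
    F^a_{m-1} F^a_{m+1}, or by M^a_m, gives

      1 + Y^a_m      = F^a_m(u - d_a/t) F^a_m(u + d_a/t) / (F^a_{m-1} F^a_{m+1}),
      1 + 1 / Y^a_m  = F^a_m(u - d_a/t) F^a_m(u + d_a/t) / M^a_m,

    where the second formula remains correct at m = 0 and m = t_a l with the
    convention 1 / Y = 0, because M^a_m = 1 there.  When the definition of Y and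
    the second formula are substituted in the Y-relation, all the factors F on
    its two sides cancel, apart from those inside M and N, and it becomes

      M^a_m(u - d_a/t) M^a_m(u + d_a/t) = N^a_m(u) M^a_{m-1}(u) M^a_{m+1}(u),

    proved below as [extM_ratio].  Both M and N are products over the neighbours
    b of a, and the identity holds for each b separately.

    If d_a > 1, tame lacing forces d_a = p d_b with p = 1 or d_b = 1.  In either
    case Z^b_{p,m} is the product of the ratios 1 + Y^b over a diamond-shaped
    set of points (j, shift), with shifts that are multiples of d_b/t, and this
    product telescopes to the four corners of the diamond ([prod_diamond]).

    If d_a = 1, write m = q d_b + rho.  Then S^b_m regroups as a ladder of length
    rho of values F^b_{q+1} times a ladder of length d_b - rho of values F^b_q,
    a ladder being a product over equally spaced points centred at u
    ([Sprod_ladder]).  The product of the two shifts of a ladder by -1/t and 1/t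
    is the product of the ladders that are one point longer and one point
    shorter ([ladder_shift]), which are those of S^b_{m-1} and S^b_{m+1}.  So
    everything cancels except when rho = 0, where a ladder of length -1 is
    missing, and exactly 1 + Y^b_q survives ([Sprod_ratio]). *)

(** * Products over equally spaced points *)

Section Ladders.
Variables (U : zmodType) (R : comUnitRingType) (w : U).
Implicit Types (h : U -> R) (u : U) (q : nat).

(** The points u + (q-1)w, u + (q-3)w, ..., u - (q-1)w, symmetric about u, are the
    ones over which the inner products of Z and the two halves of S run. *)
Definition ladder h q u : R := \prod_(k < q) h (u + w *~ (q%:Z - 1 - 2 * k%:Z)).

Lemma ladder0 h u : ladder h 0 u = 1.
Proof. by rewrite /ladder big_ord0. Qed.

Lemma ladder1 h u : ladder h 1 u = h u.
Proof. by rewrite /ladder big_ord1 mulr0 !subr0 subrr mulr0z addr0. Qed.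

Lemma eq_ladder h1 h2 q u : h1 =1 h2 -> ladder h1 q u = ladder h2 q u.
Proof. by move=> eq_h; apply: eq_bigr => k _. Qed.

Lemma ladder_unit h q u :
  (forall v, h v \is a GRing.unit) -> ladder h q u \is a GRing.unit.
Proof. by move=> hU; apply: rpred_prod => k _. Qed.

Lemma ladderM h1 h2 q u :
  ladder (fun v => h1 v * h2 v) q u = ladder h1 q u * ladder h2 q u.
Proof. by rewrite /ladder big_split. Qed.

Lemma ladder_translate h z q u :
  ladder (fun v => h (v + z)) q u = ladder h q (u + z).
Proof. by apply: eq_bigr => k _; rewrite addrAC. Qed.

Lemma ladderSl h q u : ladder h q.+1 u = h (u + w *+ q) * ladder h q (u - w).
Proof.
rewrite /ladder big_ord_recl /= mulr0 subr0 -addn1 PoszD addrK; congr (_ * _).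
apply: eq_bigr => k _; congr h.
rewrite -addrA; congr (_ + _); rewrite [RHS]addrC -{3}[w]mulr1z -mulrzBr.
by congr (_ *~ _); rewrite /bump /=; lia.
Qed.

Lemma ladderSr h q u : ladder h q.+1 u = ladder h q (u + w) * h (u - w *+ q).
Proof.
rewrite /ladder big_ord_recr /=; congr (_ * _).
  apply: eq_bigr => k _; congr h.
  rewrite -[RHS]addrA; congr (_ + _); rewrite [RHS]addrC -{3}[w]mulr1z -mulrzDr.
  by congr (_ *~ _); lia.
congr h; congr (_ + _); rewrite -[w *+ q]/(w *~ q%:Z) -mulrNz.
by congr (_ *~ _); lia.
Qed.

(** Shifting q+1 points by -w and by +w covers the q+2 points of the next ladder,
    all the interior ones twice; the repetitions are the points of the ladder
    of length q. *)
Lemma ladder_shift h q u :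
  ladder h q.+1 (u - w) * ladder h q.+1 (u + w) = ladder h q.+2 u * ladder h q u.
Proof.
rewrite [ladder h q.+2 u]ladderSl [ladder h q.+1 (u + w)]ladderSl addrK.
by rewrite -addrA -mulrS; ring.
Qed.

Lemma ladderSS h q u :
  ladder h q.+2 u = h (u - w *+ q.+1) * h (u + w *+ q.+1) * ladder h q u.
Proof.
rewrite ladderSl [ladder h q.+1 (u - w)]ladderSr subrK -addrA -opprD -mulrS.
by ring.
Qed.

Lemma ladder_nat1 h q u :
  \prod_(1 <= k < q.+1) h (u + w *~ (q%:Z + 1 - 2 * k%:Z)) = ladder h q u.
Proof.
rewrite big_add1 /= big_mkord; apply: eq_bigr => k _.
by congr (h (_ + _ *~ _)); lia.
Qed.

(** The ladder in ascending order, as it occurs in S. *)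
Lemma ladder_nat1_rev h q u :
  \prod_(1 <= k < q.+1) h (u + w *~ (2 * k%:Z - 1 - q%:Z)) = ladder h q u.
Proof.
rewrite -ladder_nat1 [RHS]big_nat_rev /=; apply: eq_big_nat => k /andP[k0 kq].
by congr (h (_ + _ *~ _)); lia.
Qed.

End Ladders.

(** * Fractions with invertible denominators *)

Section UnitFractions.
Variable R : comUnitRingType.

Lemma invr_div_unit (x y : R) :
  x \is a GRing.unit -> y \is a GRing.unit -> (x / y)^-1 = y / x.
Proof. by move=> xU yU; rewrite invrM ?unitrV // invrK. Qed.

(** The shape of the Y-relation once Y and 1 + 1 / Y are expressed by T: here x, y
    are the values of M at the shifted points, x', y' those at m - 1 and m + 1,
    and a, b, a', b' the factors T that cancel. *)
Lemma frac_exchange (x y a b a' b' N x' y' : R) :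
  a \is a GRing.unit -> b \is a GRing.unit ->
  a' \is a GRing.unit -> b' \is a GRing.unit ->
  x' \is a GRing.unit -> y' \is a GRing.unit ->
  x * y = N * (x' * y') ->
  x / (a * b) * (y / (a' * b')) = N / (a * a' / x' * (b * b' / y')).
Proof.
move=> aU bU a'U b'U x'U y'U xyE.
rewrite mulrACA xyE [(_ / _ * _)^-1]invrM ?(unitrM, unitrV) ?aU ?bU ?a'U ?b'U
  ?x'U ?y'U //.
rewrite !invr_div_unit ?(unitrM, unitrV) ?aU ?bU ?a'U ?b'U //.
by rewrite !invrM ?unitrM ?aU ?bU ?a'U ?b'U //; ring.
Qed.

(** The factors are x_(i+1) y_i / (x_i y_(i+1)), two telescoping products running
    in opposite directions. *)
Lemma telescope_prod (g x y : nat -> R) N :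
  (forall i, x i \is a GRing.unit) -> (forall i, y i \is a GRing.unit) ->
  (forall i, g i * (x i * y i.+1) = x i.+1 * y i) ->
  \prod_(i < N) g i * (x 0%N * y N) = x N * y 0%N.
Proof.
move=> xU yU gE; elim: N => [|N IHN]; first by rewrite big_ord0 mul1r.
rewrite big_ord_recr /=; apply: (mulIr (xU N)); apply: (mulIr (yU N)).
transitivity (\prod_(i < N) g i * (x 0%N * y N) * (g N * (x N * y N.+1))).
  by ring.
by rewrite IHN gE; ring.
Qed.

End UnitFractions.

(** * The diamond product *)

Section Diamond.
Variables (U : zmodType) (R : comUnitRingType) (w : U) (f : int -> U -> R).
Hypothesis fU : forall n u, f n u \is a GRing.unit.
Implicit Types (n c : int) (u : U) (p q : nat).

(** For f = T^(a) and w = d_a/t this is 1 + Y^(a)_n(u). *)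
Definition cross_ratio n u : R :=
  f n (u - w) * f n (u + w) / (f (n - 1) u * f (n + 1) u).

Lemma cross_ratioK n u :
  cross_ratio n u * (f (n - 1) u * f (n + 1) u) = f n (u - w) * f n (u + w).
Proof. by rewrite /cross_ratio divrK // unitrM !fU. Qed.

Lemma ladder_cross_ratio n q u :
  ladder w (cross_ratio n) q.+1 u
    * (ladder w (f (n - 1)) q.+1 u * ladder w (f (n + 1)) q.+1 u)
  = ladder w (f n) q.+2 u * ladder w (f n) q u.
Proof.
rewrite -ladder_shift -!ladderM -!ladder_translate -ladderM.
by apply: eq_ladder => v; rewrite cross_ratioK.
Qed.

(** Half a diamond, from its tip at c in the direction sg = 1 or -1: the row at
    distance i+1 from the tip has i+1 points.  By [ladder_cross_ratio] the product
    along a row involves only ladders of f on that row and the two adjacent ones,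
    hence the product of the rows telescopes. *)
Lemma prod_triangle (sg : int) c N u : `|sg|%N = 1%N ->
  \prod_(i < N) ladder w (cross_ratio (c + sg * (i.+1)%:Z)) i.+1 u
    * (f c u * ladder w (f (c + sg * (N.+1)%:Z)) N u)
  = ladder w (f (c + sg * N%:Z)) N.+1 u.
Proof.
move=> sg1.
have := telescope_prod N
  (g := fun i => ladder w (cross_ratio (c + sg * (i.+1)%:Z)) i.+1 u)
  (x := fun i => ladder w (f (c + sg * i%:Z)) i.+1 u)
  (y := fun i => ladder w (f (c + sg * (i.+1)%:Z)) i u).
rewrite /= mulr0 addr0 ladder1 ladder0 mulr1; apply=> i; try exact: ladder_unit.
rewrite -ladder_cross_ratio.
have [->|->] : sg = 1 \/ sg = -1 by lia.
  by congr (_ * (ladder w (f _) _ _ * ladder w (f _) _ _)); lia.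
rewrite [in RHS]mulrC -!mulrA mulrCA mulrC -mulrA.
by congr (ladder w (f _) _ _ * (_ * ladder w (f _) _ _)); lia.
Qed.

(** The diamond is cut into a triangle with tip n - p that contains the central
    row n and a triangle with tip n + p that stops at row n + 1.  The ladder
    of row n + 1 cancels between the two, and on the central row the ladders of
    lengths p + 1 and p - 1 differ by their two end points. *)
Lemma prod_diamond n p u : (0 < p)%N ->
  \prod_(0 <= i < (2 * p)%N.-1)
    (let j : int := i%:Z - (p%:Z - 1) in
     ladder w (cross_ratio (n + j)) (p - `|j|)%N u)
    * (f (n - p%:Z) u * f (n + p%:Z) u)
  = f n (u - w *+ p) * f n (u + w *+ p).
Proof.
case: p => // p _.
have lower := prod_triangle (n - p.+1%:Z) p.+1 u (erefl : `|1%:Z|%N = 1%N).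
have upper := prod_triangle (n + p.+1%:Z) p u (erefl : `|- 1%:Z|%N = 1%N).
have -> : (2 * p.+1).-1 = (p + p.+1)%N by lia.
rewrite (@big_cat_nat _ _ _ p.+1) ?leq_addl //.
rewrite -[X in \prod_(X <= _ < p + _) _]add0n big_addn addnK big_mkord.
rewrite big_nat_rev /= big_mkord.
rewrite (eq_bigr (fun i : 'I_p.+1 =>
  ladder w (cross_ratio (n - p.+1%:Z + 1 * (i.+1)%:Z)) i.+1 u)); last first.
  move=> i _; have := ltn_ord i => ip.
  by congr (ladder w (cross_ratio _) _ _); lia.
rewrite [X in _ * X * _](eq_bigr (fun i : 'I_p =>
  ladder w (cross_ratio (n + p.+1%:Z + -1 * (i.+1)%:Z)) i.+1 u)); last first.
  move=> i _; have := ltn_ord i => ip.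
  by congr (ladder w (cross_ratio _) _ _); lia.
have E1 : n - p.+1%:Z + 1 * p.+2%:Z = n + 1 by lia.
have E2 : n - p.+1%:Z + 1 * p.+1%:Z = n by lia.
have E3 : n + p.+1%:Z + -1 * p.+1%:Z = n by lia.
have E4 : n + p.+1%:Z + -1 * p%:Z = n + 1 by lia.
rewrite {}E1 {}E2 ladderSS in lower; rewrite {}E3 {}E4 in upper.
have sU m q v : ladder w (f m) q v \is a GRing.unit by exact: ladder_unit.
apply: (mulIr (sU n p u)); apply: (mulIr (sU (n + 1) p.+1 u)).
rewrite -lower -upper; ring.
Qed.

End Diamond.

(** * Regrouping the products S *)

Section Regrouping.
Variables (U : zmodType) (R : comUnitRingType) (e : U) (F : int -> U -> R).
Variable d : nat.
Hypothesis d_pos : (0 < d)%N.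
Implicit Types (m q : int) (u : U) (rho : nat).

Definition Sprod m u : R :=
  \prod_(1 <= k < d.+1)
    let E := ((m - k%:Z) %/ d%:Z)%Z in
    F (1 + E) (u + e *~ (2 * k%:Z - 1 - m + E * d%:Z)).

Lemma divz_block q (x : int) : 0 <= x < d%:Z -> ((q * d%:Z + x) %/ d%:Z)%Z = q.
Proof.
move=> /andP[x0 xd]; rewrite divzMDl; last lia.
by rewrite divz_small ?addr0 // x0 /=; lia.
Qed.

(** The quotient E takes the value q for k <= rho and q - 1 for k > rho.  Allowing
    rho = d as well lets m + 1 be treated with the same q as m. *)
Lemma Sprod_ladder q rho u : (rho <= d)%N ->
  Sprod (q * d%:Z + rho%:Z) u
  = ladder e (F (q + 1)) rho u * ladder e (F q) (d - rho) u.
Proof.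
move=> le_rho; rewrite /Sprod (@big_cat_nat _ _ _ rho.+1) //=.
congr (_ * _).
  rewrite -ladder_nat1_rev; apply: eq_big_nat => k /andP[k0 k1].
  rewrite -addrA divz_block; last lia.
  by congr (F _ (_ + _ *~ _)); lia.
rewrite -ladder_nat1_rev !big_add1 /= -[X in \prod_(X <= _ < d) _]add0n big_addn.
apply: eq_big_nat => k /andP[_ kd].
have -> : q * d%:Z + rho%:Z - (k + rho).+1%:Z = (q - 1) * d%:Z + (d%:Z - k.+1%:Z).
  by lia.
rewrite divz_block; last lia.
by congr (F _ (_ + _ *~ _)); lia.
Qed.

Hypothesis FU : forall n u, F n u \is a GRing.unit.

Lemma Sprod_unit m u : Sprod m u \is a GRing.unit.
Proof. by apply: rpred_prod => k _. Qed.

(** When d divides m, the ladder of length d of S_m turns into ladders of lengths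
    d + 1 and d - 1, whereas S_(m-1) S_(m+1) contains two of length d - 1 and the
    single values of F at q - 1 and q + 1: the two end points left over and these
    two values form the cross ratio.  Otherwise both ladders of S_m are nonempty
    and their lengths rho + 1, rho - 1, d - rho + 1, d - rho - 1 match. *)
Lemma Sprod_ratio m u :
  Sprod m (u - e) * Sprod m (u + e)
  = (if (d%:Z %| m)%Z then cross_ratio (e *+ d) F (m %/ d%:Z)%Z u else 1)
    * (Sprod (m - 1) u * Sprod (m + 1) u).
Proof.
have [q [rho [rho_d ->]]] : exists q rho, (rho < d)%N /\ m = q * d%:Z + rho%:Z.
  exists (m %/ d%:Z)%Z, `|(m %% d%:Z)%Z|%N.
  have m0 := modz_ge0 m (_ : d%:Z != 0).
  have m1 := ltz_pmod m (_ : 0 < d%:Z).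
  split; first lia.
  by rewrite {1}(divz_eq m d%:Z); congr (_ + _); lia.
have -> : (d%:Z %| q * d%:Z + rho%:Z)%Z = (rho == 0%N).
  by rewrite rpredDl ?dvdz_mull // dvdzE /= /dvdn modn_small.
have below_d : d.-1.+1 = d by rewrite prednK.
case: rho rho_d => [|rho] rho_d /=.
  have -> : q * d%:Z + 0%:Z - 1 = (q - 1) * d%:Z + d.-1%:Z by lia.
  have -> : q * d%:Z + 0%:Z + 1 = q * d%:Z + 1%:Z by lia.
  rewrite !Sprod_ladder //; try lia.
  rewrite !ladder0 !mul1r subrK !subn0 subn1 addr0 mulzK; last lia.
  have -> : (d - d.-1)%N = 1%N by lia.
  rewrite !ladder1 -below_d /= ladder_shift ladderSS -cross_ratioK //.
  by rewrite below_d; ring.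
have -> : q * d%:Z + rho.+1%:Z - 1 = q * d%:Z + rho%:Z by lia.
have -> : q * d%:Z + rho.+1%:Z + 1 = q * d%:Z + rho.+2%:Z by lia.
rewrite !Sprod_ladder //; try lia.
have -> : (d - rho)%N = (d - rho.+2).+2 by lia.
have -> : (d - rho.+1)%N = (d - rho.+2).+1 by lia.
rewrite mul1r mulrACA !ladder_shift; ring.
Qed.

End Regrouping.

(** * From the T-system to the Y-system *)

Section RestrictedSystems.
Variables (r : nat) (C : 'M[int]_r) (d : 'I_r -> nat) (l : nat).
Hypothesis hC : tamely_laced C d.
Variables (U : zmodType) (e : U) (R : comUnitRingType).
Variable T : 'I_r -> int -> U -> R.
Hypothesis TU : unit_family d l T.
Hypothesis T_sys : T_system C d l e T.
Implicit Types (a b : 'I_r) (m : int) (u : U).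

Lemma d_gt0 a : (0 < d a)%N.
Proof. by case: hC => _ [] + _ _ _; apply. Qed.

Lemma topE a : top d l a * (d a)%:Z = (lcmd d * l)%N%:Z.
Proof.
rewrite -PoszM mulnAC /lcmd_quo divnK //.
by rewrite /lcmd (bigD1 a) //= dvdn_lcml.
Qed.

(** Symmetry of D C reads d_a C_ab = d_b C_ba.  As d_a > 1, tame lacing excludes
    C_ab < -1, so C_ab = -1 and d_a = - d_b C_ba; if C_ba < -1, then d_b = 1. *)
Lemma adj_quo a b : (1 < d a)%N -> adj C a b ->
  (d a = (d a %/ d b) * d b)%N /\ ((d a %/ d b = 1)%N \/ d b = 1%N).
Proof.
case: hC => -[Cd Cle C0] [_ DC _] tame da ab.
have Cab : C a b = -1.
  have : ~ C a b < -1 by move=> /tame[]; lia.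
  by move: ab; rewrite /adj; lia.
have : (d a)%:Z * C a b = (d b)%:Z * C b a.
  have := congr1 (fun M : 'M[int]_r => M b a) DC.
  by rewrite mxE !mul_diag_mx !mxE.
have := d_gt0 a; have := d_gt0 b; rewrite Cab => db0 da0 sym.
have [/tame[-> _]|Cba] := boolP (C b a < -1).
  by rewrite divn1 muln1; split=> //; right.
have Cba_lt0 : C b a < 0 by nia.
have Cba1 : C b a = -1 by lia.
have -> : d a = d b by move: sym; rewrite Cba1; lia.
by rewrite divnn db0 mul1n; split=> //; left.
Qed.

(** Unlike the boundary convention [Tbd], this is invertible for every integer m, so
    that the telescoping identities apply without conditions on the indices. *)
Definition extT a m u : R := if in_range d l a m then T a m u else 1.

Lemma extT_unit a m u : extT a m u \is a GRing.unit.
Proof. by rewrite /extT; case: ifP => [/TU|] //; rewrite unitr1. Qed.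

Lemma Tbd_extT a m u : 0 <= m <= top d l a -> Tbd d l T a m u = extT a m u.
Proof.
rewrite /Tbd /extT /boundary /in_range => m_top.
by case: ifP; case: ifP => //; lia.
Qed.

Lemma extT_boundary a m u : boundary d l a m -> extT a m u = 1.
Proof. by rewrite /extT /boundary /in_range; case: ifP => //; lia. Qed.

Definition extM a m u : R :=
  if (1 < d a)%N then
    \prod_(b | adj C a b) extT b ((d a %/ d b)%N%:Z * m) u
  else \prod_(b | adj C a b) Sprod e (extT b) (d b) m u.

Lemma extM_unit a m u : extM a m u \is a GRing.unit.
Proof.
rewrite /extM; case: ifP => _; apply: rpred_prod => b _; first exact: extT_unit.
exact/Sprod_unit/extT_unit.
Qed.

Lemma top_quo a b : (1 < d a)%N -> adj C a b ->
  (d a %/ d b)%N%:Z * top d l a = top d l b.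
Proof.
move=> da /(adj_quo da)[da_db _].
have := topE a; rewrite -(topE b) {1}da_db; have := d_gt0 b.
set x := top d l a; set y := top d l b; set p := (d a %/ d b)%N.
rewrite PoszM mulrCA mulrA => db0 /mulIf; apply.
by lia.
Qed.

Lemma top_lcmd a b : ~~ (1 < d a)%N -> top d l a = top d l b * (d b)%:Z.
Proof.
move=> da; have da1 : d a = 1%N by have := d_gt0 a; lia.
by rewrite topE -(topE a) da1 mulr1.
Qed.

Lemma T_M_extM a m u : 0 <= m <= top d l a -> T_M C d l e T a m u = extM a m u.
Proof.
move=> m_top; rewrite /T_M /extM; case: ifP => [da|/negbT da].
  apply: eq_bigr => b ab; rewrite Tbd_extT //.
  by case/andP: m_top => m0 m1; rewrite -(top_quo da ab) mulr_ge0 //= ler_wpM2l.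
apply: eq_bigr => b ab; rewrite /T_S /Sprod; apply: eq_big_nat => k k_d.
rewrite Tbd_extT //; have top_ab := top_lcmd b da.
have := divz_eq (m - k%:Z) (d b)%:Z.
have := modz_ge0 (m - k%:Z) (_ : (d b)%:Z != 0).
have := ltz_pmod (m - k%:Z) (_ : 0 < (d b)%:Z).
have := d_gt0 b.
move: (_ %/ _)%Z (_ %% _)%Z => E x db0 /(_ ltac:(lia)) x_d /(_ ltac:(lia)) x0 mE.
by apply/andP; split; nia.
Qed.

(** The boundary values of a correspond to the boundary values of its neighbours:
    all the indices occurring in M^a_m are 0, respectively t_b l.  For d_a = 1
    this is the case rho = 0 of [Sprod_ladder], with q = 0 or q = t_b l. *)
Lemma extM_boundary a m u : boundary d l a m -> extM a m u = 1.
Proof.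
move=> m_bd; rewrite /extM; case: ifP => [da|/negbT da]; apply: big1 => b ab.
  apply: extT_boundary; rewrite /boundary -(top_quo da ab).
  by case/orP: m_bd => /eqP->; rewrite ?mulr0 ?eqxx ?orbT.
have [q q_bd ->] : exists2 q, boundary d l b q & m = q * (d b)%:Z + 0%:Z.
  case/orP: m_bd => /eqP->; [exists 0 | exists (top d l b)];
    rewrite /boundary ?eqxx ?orbT ?mul0r // addr0; exact: top_lcmd.
rewrite Sprod_ladder ?d_gt0 // ladder0 mul1r /ladder big1 // => k _.
exact: extT_boundary.
Qed.

Notation Y := (Y_of_T C d l e T).

Lemma Y_extE a m u : in_range d l a m ->
  Y a m u = extM a m u / (extT a (m - 1) u * extT a (m + 1) u).
Proof.
rewrite /in_range => m_in.
by rewrite /Y_of_T T_M_extM ?Tbd_extT //; lia.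
Qed.

Lemma Y_unit : unit_family d l Y.
Proof.
move=> a m u m_in.
by rewrite Y_extE // unitrM unitrV unitrM extM_unit !extT_unit.
Qed.

Lemma extT_system a m u : in_range d l a m ->
  extT a m (u - e *+ d a) * extT a m (u + e *+ d a)
  = extT a (m - 1) u * extT a (m + 1) u + extM a m u.
Proof.
move=> m_in; have := T_sys u m_in.
rewrite {1 2}/extT m_in => ->; move: m_in; rewrite /in_range => m_in.
by rewrite T_M_extM ?Tbd_extT //; lia.
Qed.

Lemma add1Y a m u : in_range d l a m ->
  1 + Y a m u = cross_ratio (e *+ d a) (extT a) m u.
Proof.
move=> m_in; rewrite /cross_ratio extT_system // Y_extE // mulrDl divrr //.
by rewrite unitrM !extT_unit.
Qed.

Lemma add1Yinv a m u : 0 <= m <= top d l a ->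
  1 + Yinvbd d l Y a m u
  = extT a m (u - e *+ d a) * extT a m (u + e *+ d a) / extM a m u.
Proof.
move=> m_top; rewrite /Yinvbd; case: ifP => [m_bd|m_nbd].
  by rewrite !extT_boundary // extM_boundary // addr0 !mul1r invr1.
have m_in : in_range d l a m by move: m_nbd; rewrite /boundary /in_range; lia.
rewrite extT_system // Y_extE // invr_div_unit ?extM_unit ?unitrM ?extT_unit //.
by rewrite mulrDl divrr ?extM_unit // addrC.
Qed.

(** All that remains of the Y-relation after substituting [Y_extE] and
    [add1Yinv]; the ratio is computed neighbour by neighbour. *)
Lemma extM_ratio a m u : in_range d l a m ->
  extM a m (u - e *+ d a) * extM a m (u + e *+ d a)
  = Y_N C d e Y a m u * (extM a (m - 1) u * extM a (m + 1) u).
Proof.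
rewrite /extM /Y_N; case: ifP => [da|/negbT da] m_in;
  rewrite -!big_split /=; apply: eq_bigr => b ab.
  have [da_db p_db] := adj_quo da ab; have tb := top_quo da ab.
  have db0 := d_gt0 b; move: da_db p_db tb; set p := (d a %/ d b)%N.
  move=> da_db p_db tb; have p0 : (0 < p)%N by case: p da_db {p_db tb} => //; lia.
  rewrite da_db mulnC mulrnA.
  have -> : p%:Z * (m - 1) = p%:Z * m - p%:Z by lia.
  have -> : p%:Z * (m + 1) = p%:Z * m + p%:Z by lia.
  rewrite -prod_diamond //; last exact: extT_unit.
  congr (_ * _); rewrite /Y_Z; apply: eq_big_nat => i /andP[_ i_p] /=.
  rewrite -ladder_nat1; apply: eq_big_nat => k /andP[k0 k_p].
  rewrite add1Y; last by move: m_in; rewrite /in_range -tb; nia.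
  congr (cross_ratio _ _ _ (_ + _)); case: p_db => [p1|->].
    (* The diamond is the single point j = 0, k = 1, and both shifts vanish. *)
    by transitivity (0 : U); [rewrite -(mulr0z (e *+ d b)) | rewrite -(mulr0z e)];
      congr (_ *~ _); lia.
  by rewrite mulr1n; congr (_ *~ _); lia.
have da1 : d a = 1%N by have := d_gt0 a; lia.
rewrite da1 mulr1n Sprod_ratio ?d_gt0 //; last exact: extT_unit.
congr (_ * _); rewrite /Yquo; case: ifP => [/dvdzP[q mE]|_]; last by rewrite addr0.
have db0 := d_gt0 b; rewrite add1Y // mE mulzK; last by lia.
by move: m_in; rewrite /in_range (top_lcmd b da) mE; nia.
Qed.

Theorem Y_system_of_T_system : Y_system C d l e Y.
Proof.
move=> a m u m_in /=.
have m_top : 1 <= m <= top d l a - 1 by [].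
rewrite !add1Yinv; try lia.
have U_ v n w : extT v n w \is a GRing.unit by exact: extT_unit.
have MU n v : extM a n v \is a GRing.unit by exact: extM_unit.
split; first by rewrite !(unitrM, unitrV) !U_ !MU.
by rewrite !Y_extE //; apply: frac_exchange => //; exact: extM_ratio.
Qed.

End RestrictedSystems.

Theorem theorem5p3
  (r : nat) (C : 'M[int]_r) (d : 'I_r -> nat) (hC : tamely_laced C d)
  (l : nat) (hl : (2 <= l)%N)
  (K : realType) (s : spectral_domain K)
  (R : comUnitRingType)
  (T : 'I_r -> int -> spectral (lcmd d) s -> R)
  (hTunit : unit_family d l T)
  (hT : T_system C d l (spectral_inv (lcmd d) s) T) :
  let Y := Y_of_T C d l (spectral_inv (lcmd d) s) T in
  unit_family d l Y /\
  Y_system C d l (spectral_inv (lcmd d) s) Y.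
Proof.
exact (conj (Y_unit hC _ hTunit) (Y_system_of_T_system hC hTunit hT)).
Qed.
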